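(* Let $r$ be a positive integer, $\boldsymbol{\omega}=(\omega_1,\ldots,\omega_r)$ an $r$-tuple of positive real numbers and $a\ge0$. Then, as $x\to0^+$, \[ M_r(x;\boldsymbol{\omega},a)=\frac{1}{\Gamma(x+1)}\sum_{k=0}^r(-1)^k\Lambda_k(\boldsymbol{\omega})\frac{(r-k)!}{x^{r-k}}+O(x). \] In particular, $M_r(x;(1,\ldots,1),0)=\frac{1}{\Gamma(x+1)}\frac{r!}{x^r}+O(x)$ as $x\to0^+$.
   Context: For real $x>0$, \[ M_r(x;\boldsymbol{\omega},a)=\sum_{n_1,\ldots,n_r\ge1}\frac{1}{n_1\cdots n_r(\omega_1n_1+\cdots+\omega_rn_r+a)^x}. \] $\Gamma$ is the gamma function. $\Lambda_0(\boldsymbol{\omega})=1$ and, for $k\ge1$, $\Lambda_k(\boldsymbol{\omega})=\sum_{1\le i_1<\cdots<i_k\le r}\log\omega_{i_1}\cdots\log\omega_{i_k}$. *)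

(* Defs.v *)
From HB Require Import structures.
From mathcomp Require Import all_boot all_order all_algebra.
From mathcomp Require Import all_classical all_reals all_analysis.

Set Implicit Arguments.
Unset Strict Implicit.
Unset Printing Implicit Defensive.

Import Order.TTheory GRing.Theory Num.Theory.
Import numFieldNormedType.Exports.

Local Open Scope classical_set_scope.
Local Open Scope ring_scope.

(* Euler's integral; the integral converges for x > 0, and [Rintegral] is 0
   where it does not. *)
Definition Gamma (R : realType) (x : R) : R :=
  \int[lebesgue_measure]_(t in `]0, +oo[) (t `^ (x - 1) * expR (- t)).

(* The terms are nonnegative when [w] is positive and [a] and [x] are
   nonnegative, so the r-fold series is their unordered sum, taken in the
   extended reals: a finite value is convergence. *)
Definition Mseries (R : realType) (r : nat) (x : R) (w : 'I_r -> R) (a : R)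
    : \bar R :=
  \esum_(n in [set n : {ffun 'I_r -> nat} | forall i, (1 <= n i)%N])
    ((\prod_(i < r) (n i)%:R * (\sum_(i < r) w i * (n i)%:R + a) `^ x)^-1)%:E.

(* The index tuples i_1 < ... < i_k are the k-element subsets of 'I_r. *)
Definition Lambda (R : realType) (r k : nat) (w : 'I_r -> R) : R :=
  \sum_(A : {set 'I_r} | #|A| == k) \prod_(i in A) ln (w i).

(* Main.v *)
(* Write [s = w_1 n_1 + ... + w_r n_r + a].  Since [Gamma (x + 1) * s^-x] is the
   integral of [x t^(x-1) e^(-s t)] over [t > 0], summing over the [n_i] gives
   [Gamma (x + 1) * M_r = \int_0^oo x t^(x-1) F(t) dt] with
   [F(t) = e^(-a t) * \prod_i (- ln (1 - e^(- w_i t)))].  Near [0],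
   [- ln (1 - e^(-z))] lies between [- ln z] and [- ln z + z], so [F(t)] is
   [\prod_i (- ln t - ln w_i)] up to [O(t (1 + |ln t|)^r)], and the integral of
   [x t^(x-1) (- ln t)^m] over [0 < t <= 1] is [m! / x^m]: expanding the product
   gives the main term exactly.  The error on [0 < t <= 1] and the exponentially
   small tail on [t > 1] both contribute [O(x)], because of the factor [x]. *)

Require Import Defs.
From HB Require Import structures.
From mathcomp Require Import all_boot all_order all_algebra.
From mathcomp Require Import all_classical all_reals all_analysis.
From mathcomp Require Import measurable_realfun ring lra.

Import Order.TTheory GRing.Theory Num.Theory.
Import numFieldNormedType.Exports.

Local Open Scope classical_set_scope.
Local Open Scope ring_scope.

Set Implicit Arguments.
Unset Strict Implicit.
Unset Printing Implicit Defensive.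

(** * Elementary integrals *)

(** The integrand may blow up at [0], so the fundamental theorem is applied on segments [b/(n+2), b]
    that increase to ]0, b]. Nonnegativity lets monotone convergence carry the integrals to the
    limit, and [F] contributes nothing at [0]. *)
Lemma ge0_FTC_right0 (R : realType) (f F : R -> R) (b : R) : 0 < b ->
  (forall t : R, 0 < t -> t <= b -> 0 <= f t) ->
  (forall t : R, 0 < t -> {for t, continuous f}) ->
  (forall t : R, 0 < t -> is_derive t 1 F (f t)) ->
  F t @[t --> 0^'+] --> 0 ->
  (\int[lebesgue_measure]_(t in `]0%R, b]) (f t)%:E = (F b)%:E)%E.
Proof.
move=> b0 f0 cf dF F0.
(* The shift to [n.+2] keeps every segment nondegenerate, including the one for [n = 0]. *)
have bpos n : 0 < b / n.+2%:R by rewrite divr_gt0.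
have bltb n : b / n.+2%:R < b.
  by rewrite ltr_pdivrMr// ltr_pMr// (_ : 1 = 1%:R)// ltr_nat.
pose D n : set R := `[b / n.+2%:R, b]%classic.
have cF t : 0 < t -> {for t, continuous F}.
  move=> t0; apply/differentiable_continuous/derivable1_diffP.
  by have [] := dF t t0.
have UD : \bigcup_n D n = `]0, b]%classic.
  apply/seteqP; split=> [t [n _]|t]; rewrite /D /= !in_itv/=.
    by move=> /andP[nt ->]; rewrite (lt_le_trans _ nt).
  move=> /andP[t0 tb].
  (* With n the integer part of b/t, b/t < n + 1 < n + 2, so [t] lies above b/(n+2). *)
  exists (Num.truncn (b / t)) => //=; rewrite in_itv/= tb andbT.
  rewrite ler_pdivrMr// mulrC -ler_pdivrMr// ltW//.
  by rewrite (lt_trans (truncnS_gt _))// ltr_nat.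
have mD n : measurable (D n) by exact: measurable_itv.
have DP n t : D n t -> 0 < t /\ t <= b.
  by rewrite /D /= in_itv/= => /andP[h ->]; rewrite (lt_le_trans _ h).
have cfD n : {within D n, continuous f}.
  apply: continuous_in_subspaceT => t; rewrite inE => /DP[t0 _].
  exact: cf.
have cv : (\int[lebesgue_measure]_(x in D n) (f x)%:E @[n --> \oo] -->
    \int[lebesgue_measure]_(x in \bigcup_n D n) (f x)%:E)%E.
  apply: ge0_nondecreasing_set_cvg_integral => //.
  - move=> m n mn; rewrite subsetEset => t; rewrite /D /= !in_itv/=.
    move=> /andP[h ->]; rewrite andbT (le_trans _ h)//.
    by rewrite ler_pM2l// lef_pV2 ?posrE// ler_nat.
  - move=> n; apply/measurable_EFinP.
    by apply: subspace_continuous_measurable_fun => //; exact: cfD.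
  - by move=> n t /DP[t0 tb]; rewrite lee_fin f0.
rewrite -UD; apply: (cvg_unique _ cv) => //.
have -> : (fun n => (\int[lebesgue_measure]_(x in D n) (f x)%:E)%E) =
   (fun n => (F b - F (b / n.+2%:R))%:E).
  apply/funext => n; rewrite EFinB; apply: continuous_FTC2 => //.
  - exact: cfD.
  - split.
    + move=> t; rewrite in_itv/= => /andP[h _].
      by have [] := dF t (lt_trans (bpos n) h).
    + exact/cvg_at_right_filter/cF.
    + exact/cvg_at_left_filter/cF.
  - move=> t; rewrite in_itv/= => /andP[h _].
    by rewrite derive1E; have [_ ->] := dF t (lt_trans (bpos n) h).
apply: cvg_EFin; first exact: nearW.
rewrite -[X in _ --> X](subr0 (F b)).
apply: cvgB; first exact: cvg_cst.
move/cvg_at_rightP : F0; apply; split => [n|]; first exact: bpos.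
rewrite -[X in _ --> X](mulr0 b); apply: cvgM; first exact: cvg_cst.
have := @cvg_harmonic R; rewrite -(cvg_shiftS (@harmonic R)); exact.
Qed.

Section power_integrals.
Context {R : realType}.
Implicit Types (x t c k : R) (m : nat).
Notation mu := (@lebesgue_measure R).

Lemma continuous_powR x t : 0 < t -> {for t, continuous (fun s : R => s `^ x)}.
Proof.
move=> t0; apply/differentiable_continuous/derivable1_diffP.
by have [] := is_derive1_powR x t0.
Qed.

Lemma integral_powR_itv0c x c : 0 < x -> 0 < c ->
  (\int[mu]_(t in `]0%R, c]) (x * t `^ (x - 1))%:E = (c `^ x)%:E)%E.
Proof.
move=> x0 c0; apply: (ge0_FTC_right0 (F := fun s : R => s `^ x)) => //.
- by move=> t t0 _; rewrite mulr_ge0 ?powR_ge0// ltW.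
- by move=> t t0; apply: continuousM; [exact: cst_continuous|exact: continuous_powR].
- exact: powR_cvg0.
Qed.

Lemma integral_expRN_itvcy k c : 0 < k ->
  (\int[mu]_(t in `[c, +oo[) (k * expR (- (k * t)))%:E = (expR (- (k * c)))%:E)%E.
Proof.
move=> k0.
have cE : continuous (fun t : R => expR (- (k * t))).
  move=> t; apply/differentiable_continuous/derivable1_diffP; exact: ex_derive.
have dE t : is_derive t 1 (fun t => - expR (- (k * t))) (k * expR (- (k * t))).
  apply: is_derive_eq; rewrite /GRing.scale/=; ring.
rewrite (@ge0_continuous_FTC2y _ _ (fun t => - expR (- (k * t))) c 0)//.
- by rewrite EFinN oppeK add0e.
- by move=> t _; rewrite mulr_ge0 ?expR_ge0// ltW.
- apply: continuous_subspaceT => t.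
  by apply/differentiable_continuous/derivable1_diffP; exact: ex_derive.
- rewrite -oppr0; apply: cvgN.
  apply: (@cvg_comp _ _ _ (fun t : R => k * t) (fun z => expR (- z)) _ (pinfty_nbhs R)).
    exact: gt0_cvgMry.
  exact: cvgr_expR.
- by apply: cvgN; apply/cvg_at_right_filter; exact: cE.
- by move=> t _; rewrite derive1E; have [_ ->] := dE t.
Qed.

(** Each factor - ln t is at most t^(-e)/e. Taking e = x/(m+1), the [m] logarithms use up only
    t^(-em), and a factor t^e is left to force the limit. *)
Lemma powR_ln_cvg0 x m : 0 < x -> t `^ x * (- ln t) ^+ m @[t --> 0^'+] --> 0.
Proof.
move=> x0; pose e := x / m.+1%:R.
have e0 : 0 < e by rewrite divr_gt0.
have xe : x - e * m%:R = e.
  have {1}-> : x = e * m.+1%:R by rewrite mulfVK.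
  by rewrite -natr1; ring.
apply: (@squeeze_cvgr _ _ _ _ (fun=> 0) (fun t => e ^- m * t `^ e)).
- near=> t.
  have t0 : 0 < t by [].
  have t1 : t <= 1 by near: t; apply: nbhs_right_le.
  have l0 : 0 <= - ln t by rewrite oppr_ge0 ln_le0.
  have lt : - ln t <= e^-1 * t `^ (- e).
    rewrite ler_pdivlMl// mulrN -mulNr -ln_powR ltW// ln_sublinear//.
    exact: powR_gt0.
  rewrite mulr_ge0 ?powR_ge0 ?exprn_ge0//=.
  rewrite (le_trans (ler_wpM2l (powR_ge0 _ _) (lerXn2r m _ _ lt)))//.
    by rewrite nnegrE mulr_ge0 ?powR_ge0// invr_ge0 ltW.
  rewrite exprMn exprVn mulrCA -(powR_mulrn m (powR_ge0 t (- e))).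
  rewrite -powRrM -powRD.
    by rewrite mulNr xe.
  by apply/implyP => _; rewrite gt_eqF.
- exact: cvg_cst.
- rewrite -[X in _ --> X](mulr0 (e ^- m)); apply: cvgM; first exact: cvg_cst.
  exact: powR_cvg0.
Unshelve. all: by end_near. Qed.

(** The recursion is integration by parts of x t^(x-1) (- ln t)^m, with the logarithm differentiated
    at each stage; this is the primitive that tends to [0] at the origin. *)
Fixpoint powR_ln_primitive x m t : R :=
  if m is m'.+1 then
    t `^ x * (- ln t) ^+ m + m%:R / x * powR_ln_primitive x m' t
  else t `^ x.

Lemma is_derive_powR_ln_primitive x m t : 0 < x -> 0 < t ->
  is_derive t 1 (powR_ln_primitive x m) (x * t `^ (x - 1) * (- ln t) ^+ m).
Proof.
move=> x0 t0; elim: m => [|m IH] /=.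
  by rewrite expr0 mulr1; exact: is_derive1_powR.
have dL : is_derive t 1 (fun s : R => - ln s) (- t^-1).
  by apply: is_deriveN; exact: is_derive1_ln.
have dp := is_deriveM (is_derive1_powR x t0) (is_deriveX m.+1 dL).
have dc := is_deriveM (is_derive_cst (m.+1%:R / x) t 1) IH.
have := is_deriveD dp dc; rewrite exprfctE => dq.
apply: is_derive_eq.
rewrite /GRing.scale/= -(mulr_powRB1 (ltW t0) x0) /cst exprS /=.
by field; rewrite !gt_eqF.
Qed.

Lemma powR_ln_primitive_cvg0 x m : 0 < x ->
  powR_ln_primitive x m t @[t --> 0^'+] --> 0.
Proof.
move=> x0; elim: m => [|m IH]; first exact: powR_cvg0.
rewrite -[X in _ --> X]addr0; apply: cvgD; first exact: powR_ln_cvg0.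
by rewrite -[X in _ --> X](mulr0 (m.+1%:R / x)); apply: cvgM => //; exact: cvg_cst.
Qed.

(** All logarithms vanish at [1], so only the coefficients m/x of the recursion survive and multiply
    up. *)
Lemma powR_ln_primitive1 x m : 0 < x ->
  powR_ln_primitive x m 1 = m`!%:R / x ^+ m.
Proof.
move=> x0; elim: m => [|m IH] /=; first by rewrite powR1 divr1.
rewrite ln1 oppr0 expr0n mulr0 add0r IH factS natrM exprS.
by rewrite mulf_div.
Qed.

Lemma integral_powR_ln x m : 0 < x ->
  (\int[mu]_(t in `]0%R, 1%R]) (x * t `^ (x - 1) * (- ln t) ^+ m)%:E =
  (m`!%:R / x ^+ m)%:E)%E.
Proof.
move=> x0; rewrite -powR_ln_primitive1//.
apply: (ge0_FTC_right0 (F := powR_ln_primitive x m)) => //.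
- move=> t t0 t1; rewrite !mulr_ge0 ?powR_ge0// ?(ltW x0)//.
  by rewrite exprn_ge0// oppr_ge0 ln_le0.
- move=> t t0; apply: continuousM.
    by apply: continuousM; [exact: cst_continuous|exact: continuous_powR].
  apply: (@continuous_comp _ _ _ (fun t => - ln t) (fun y => y ^+ m)).
    by apply: continuousN; exact: continuous_ln.
  exact: exprn_continuous.
- by move=> t t0; exact: is_derive_powR_ln_primitive.
- exact: powR_ln_primitive_cvg0.
Qed.

End power_integrals.

(** * The Gamma integral *)

Section Gamma_integral.
Context {R : realType}.
Implicit Types (x t u s : R).
Notation mu := (@lebesgue_measure R).

Lemma measurable_expRNM s (D : set R) :
  measurable_fun D (fun t : R => expR (- (s * t))).
Proof.
apply: measurable_funTS; apply: continuous_measurable_fun => t.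
by apply/differentiable_continuous/derivable1_diffP; exact: ex_derive.
Qed.

Lemma measurable_powR_expR x s (D : set R) :
  measurable_fun D (fun t : R => x * t `^ (x - 1) * expR (- (s * t))).
Proof.
apply: measurable_funM; last exact: measurable_expRNM.
by apply: measurable_funM => //; apply: measurable_funTS; exact: measurable_powR.
Qed.

(* Both sides are evaluations of the double integral of
   [x * t `^ (x - 1) * expR (- u)] over the region [0 < t, s * t <= u]. *)
Lemma integral_powR_expR x s : 0 < x -> 0 < s ->
  (\int[mu]_(t in `]0%R, +oo[) (x * t `^ (x - 1) * expR (- (s * t)))%:E =
   (s `^ (- x))%:E * \int[mu]_(t in `]0%R, +oo[) (t `^ x * expR (- t))%:E)%E.
Proof.
move=> x0 s0.
pose A : set (R * R) := [set z | 0 < z.2 /\ s * z.2 <= z.1].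
pose g (z : R * R) : \bar R := (x * z.2 `^ (x - 1) * expR (- z.1))%:E.
have AE (u t : R) : ((u, t) \in A) = (0 < t) && (s * t <= u).
  by apply/idP/andP; rewrite inE.
have mA : measurable A.
  have mB : measurable_fun setT (fun z : R * R => z.1 - s * z.2).
    apply: measurable_funB; first exact: measurable_fst.
    by apply: measurable_funM => //; exact: measurable_snd.
  have -> : A = (snd @^-1` `]0, +oo[) `&`
                ((fun z : R * R => z.1 - s * z.2) @^-1` `[0, +oo[).
    by apply/seteqP; split => -[u t] /=;
       rewrite !in_itv/= !andbT subr_ge0.
  apply: measurableI; rewrite -[X in measurable X]setTI.
    exact: (@measurable_snd _ _ R R).
  exact: mB.
have mg : measurable_fun setT g.
  apply/measurable_EFinP; apply: measurable_funM.
    apply: measurable_funM => //.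
    apply: (@measurableT_comp _ _ _ _ _ _ (fun t : R => t `^ (x - 1)) setT snd).
      exact: measurable_powR.
    exact: measurable_snd.
  apply: measurableT_comp => //.
  by apply: measurableT_comp => //; exact: measurable_fst.
have g0 z : (0 <= g z)%E.
  by rewrite lee_fin !mulr_ge0 ?powR_ge0 ?expR_ge0// ltW.
have mgA : measurable_fun setT (g \_ A).
  by apply/(measurable_restrictT g mA); exact: measurable_funTS.
have gA0 z : (0 <= (g \_ A) z)%E by apply: erestrict_ge0.
have := fubini_tonelli (m1 := mu) (m2 := mu) (g \_ A) mgA gA0.
(* Slice at fixed u > 0: [t] runs over ]0, u/s], which yields (u/s)^x e^(-u). *)
have El u : (\int[mu]_t (g \_ A) (u, t) =
   ((fun u => ((s `^ (- x))%:E * (u `^ x * expR (- u))%:E)) \_ `]0%R, +oo[) u)%E.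
  rewrite [RHS]patchE mem_setE in_itv/= andbT; case: ltP => u0; last first.
    rewrite integral0_eq// => t _; rewrite patchE memNset//= => -[t0].
    by apply/negP; rewrite -ltNge (le_lt_trans u0)// mulr_gt0.
  have us : 0 < u / s by rewrite divr_gt0.
  transitivity (\int[mu]_t ((fun t => (expR (- u))%:E *
      (x * t `^ (x - 1))%:E) \_ `]0%R, (u / s)%R]) t)%E.
    apply: eq_integral => t _; rewrite !patchE AE mem_setE in_itv/=.
    by rewrite ler_pdivlMr// (mulrC s) /g /= -EFinM (mulrC (expR _)).
  rewrite -integral_mkcond ge0_integralZl_EFin ?expR_ge0//; last 2 first.
  - by move=> t _; rewrite lee_fin mulr_ge0 ?powR_ge0// ltW.
  - apply/measurable_EFinP/measurable_funM => //.
    by apply: measurable_funTS; exact: measurable_powR.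
  rewrite integral_powR_itv0c// -!EFinM; congr EFin.
  rewrite mulrA mulrC; congr (_ * _).
  rewrite powRN -[in RHS](divfK (lt0r_neq0 s0) u) [in RHS]powRM ?ltW//.
  by rewrite [RHS]mulrC mulfK// gt_eqF// powR_gt0.
(* Slice at fixed t > 0: [u] runs over [st, +oo[, and the exponential tail there is e^(-st). *)
have Er t : (\int[mu]_u (g \_ A) (u, t) =
   ((fun t => (x * t `^ (x - 1) * expR (- (s * t)))%:E) \_ `]0%R, +oo[) t)%E.
  rewrite [RHS]patchE mem_setE in_itv/= andbT; case: ltP => t0; last first.
    rewrite integral0_eq// => u _; rewrite patchE memNset//= => -[/= h _].
    by move: h; rewrite ltNge t0.
  transitivity (\int[mu]_u ((fun u => (x * t `^ (x - 1))%:E *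
      (1 * expR (- (1 * u)))%:E) \_ `[(s * t)%R, +oo[) u)%E.
    apply: eq_integral => u _; rewrite !patchE AE mem_setE in_itv/= andbT.
    by rewrite t0 !mul1r -EFinM.
  rewrite -integral_mkcond ge0_integralZl_EFin ?mulr_ge0 ?powR_ge0 ?(ltW x0)//;
    last first.
    apply/measurable_EFinP/measurable_funM => //; exact: measurable_expRNM.
  by rewrite integral_expRN_itvcy// mul1r EFinM.
under eq_integral do rewrite El.
under [in X in _ = X -> _]eq_integral do rewrite Er.
rewrite -!integral_mkcond => <-.
rewrite ge0_integralZl//.
- apply/measurable_EFinP/measurable_funTS/measurable_funM.
    exact: measurable_powR.
  exact: measurableT_comp.
- by move=> t _; rewrite lee_fin mulr_ge0 ?powR_ge0 ?expR_ge0.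
- by rewrite lee_fin powR_ge0.
Qed.

Let measurable_Gamma_integrand x (D : set R) :
  measurable_fun D (fun t : R => (t `^ x * expR (- t))%:E).
Proof.
apply/measurable_EFinP/measurable_funTS/measurable_funM.
  exact: measurable_powR.
exact: measurableT_comp.
Qed.

(** Raise y <= e^y to the power [x], with y = t/(2x). The rate 1/2 leaves e^(-t/2) available when
    the bound is multiplied by e^(-t). *)
Lemma powR_le_expR x t : 0 < x -> 0 <= t ->
  t `^ x <= (2 * x) `^ x * expR (2^-1 * t).
Proof.
move=> x0 t0; have x20 : 0 < 2 * x by rewrite mulr_gt0.
have -> : 2^-1 * t = t / (2 * x) * x.
  by rewrite invfM mulrA mulfVK ?gt_eqF// mulrC.
rewrite expRM -powRM ?expR_ge0// ?(ltW x20)//.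
apply: ge0_ler_powR; rewrite ?nnegrE ?(ltW x0)//.
  by rewrite mulr_ge0 ?expR_ge0// ltW.
rewrite mulrC -ler_pdivrMr// (le_trans _ (expR_ge1Dx _))//.
by rewrite lerDr.
Qed.

(** [Gamma] is a real-valued integral, which would collapse an infinite value to [0]. The content is
    therefore finiteness, obtained by comparison with a multiple of e^(-t/2). *)
Lemma GammaE x : 0 < x ->
  (\int[mu]_(t in `]0%R, +oo[) (t `^ x * expR (- t))%:E = (Gamma (x + 1))%:E)%E.
Proof.
move=> x0; rewrite /Gamma /Rintegral addrK fineK// ge0_fin_numE; last first.
  by apply: integral_ge0 => t _; rewrite lee_fin mulr_ge0 ?powR_ge0 ?expR_ge0.
pose h (t : R) : \bar R :=
  ((2 * (2 * x) `^ x)%:E * (2^-1 * expR (- (2^-1 * t)))%:E)%E.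
have mh (D : set R) : measurable_fun D h.
  apply: measurable_funTS; apply/measurable_EFinP/measurable_funM => //.
  by apply: measurable_funM => //; exact: measurable_expRNM.
have h0 t : (0 <= h t)%E by rewrite lee_fin !mulr_ge0 ?powR_ge0 ?expR_ge0.
apply: (@le_lt_trans _ _ (\int[mu]_(t in `]0%R, +oo[) h t)%E).
  apply: ge0_le_integral => //.
  - by move=> t _; rewrite lee_fin mulr_ge0 ?powR_ge0 ?expR_ge0.
  - exact: measurable_Gamma_integrand.
  - exact: mh.
  - move=> t; rewrite /= in_itv/= andbT => t0; rewrite lee_fin.
    have -> : 2 * (2 * x) `^ x * (2^-1 * expR (- (2^-1 * t))) =
      (2 * x) `^ x * expR (2^-1 * t) * expR (- t).
      rewrite -[RHS]mulrA -expRD (_ : 2^-1 * t - t = - (2^-1 * t)); first by field.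
      by field.
    by rewrite ler_wpM2r ?expR_ge0// powR_le_expR// ltW.
apply: (@le_lt_trans _ _ (\int[mu]_(t in `[0%R, +oo[) h t)%E).
  apply: ge0_subset_integral => //; first exact: mh.
  by move=> t; rewrite /= !in_itv/= !andbT => /ltW.
rewrite ge0_integralZl_EFin ?mulr_ge0 ?powR_ge0//; last first.
  by apply/measurable_EFinP/measurable_funM => //; exact: measurable_expRNM.
by rewrite integral_expRN_itvcy// ltry.
Qed.

(** On t >= 1 the factor t^x is at least 1, and the integral of e^(-t) there is e^(-1). The bound is
    uniform in [x], so dividing by [Gamma (x + 1)] preserves an O(x) error. *)
Lemma Gamma_ge_expRN1 x : 0 < x -> expR (- 1) <= Gamma (x + 1).
Proof.
move=> x0; rewrite -lee_fin -GammaE//.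
have := @integral_expRN_itvcy R 1 1 ltr01; rewrite mul1r => <-.
apply: (@le_trans _ _
  (\int[mu]_(t in `[1%R, +oo[) (t `^ x * expR (- t))%:E)%E).
  apply: ge0_le_integral => //.
  - by apply/measurable_EFinP/measurable_funM => //; exact: measurable_expRNM.
  - exact: measurable_Gamma_integrand.
  - move=> t; rewrite /= in_itv/= andbT => t1.
    rewrite lee_fin !mul1r ler_peMl ?expR_ge0//.
    by rewrite -(powRr0 t) ler_powR// ltW.
apply: ge0_subset_integral => //.
- exact: measurable_Gamma_integrand.
- by move=> t _; rewrite lee_fin mulr_ge0 ?powR_ge0 ?expR_ge0.
- by move=> t; rewrite /= !in_itv/= !andbT; exact: lt_le_trans.
Qed.

Lemma Gamma_gt0 x : 0 < x -> 0 < Gamma (x + 1).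
Proof. by move=> /Gamma_ge_expRN1; exact: lt_le_trans (expR_gt0 _). Qed.

End Gamma_integral.

(** * The function [- ln (1 - expR (- z))] *)

Section log_series.
Context {R : realType}.
Implicit Types (q s z t : R) (N : nat).

(** Partial sum of the Taylor series of - ln (1 - q); the ordinal [n] carries the exponent n + 1. *)
Definition log_sum N q : R := \sum_(n < N) q ^+ n.+1 / n.+1%:R.

(** The derivative of [log_sum N] is a finite geometric sum, so the remainder has the geometric tail
    as derivative. *)
Let is_derive_log_sum N s : s < 1 ->
  is_derive s 1 (fun q => - ln (1 - q) - log_sum N q) (s ^+ N / (1 - s)).
Proof.
move=> s1; have s0 : 0 < 1 - s by rewrite subr_gt0.
elim: N => [|N IH].
  have -> : (fun q => - ln (1 - q) - log_sum 0 q) = (fun q => - ln (1 - q)).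
    by apply/funext => q; rewrite /log_sum big_ord0 subr0.
  have dl : is_derive (1 - s) 1 (@ln R) (1 - s)^-1 by exact: is_derive1_ln.
  have d1 : is_derive s 1 (fun q : R => 1 - q) (- 1).
    by apply: is_derive_eq; ring.
  have := is_deriveN (@is_derive1_comp R (@ln R) (fun q => 1 - q) s _ _ dl d1).
  rewrite mulrN mulr1 opprK => d2.
  by apply: is_derive_eq; rewrite expr0 mul1r.
have -> : (fun q => - ln (1 - q) - log_sum N.+1 q) =
    (fun q => - ln (1 - q) - log_sum N q - N.+1%:R^-1 * q ^+ N.+1).
  apply/funext => q; rewrite /log_sum big_ord_recr/=; ring.
have dX : is_derive s 1 (fun q : R => N.+1%:R^-1 * q ^+ N.+1) (s ^+ N).
  have := is_deriveM (is_derive_cst (N.+1%:R^-1 : R) s 1)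
    (is_deriveX N.+1 (is_derive_id s 1)).
  rewrite exprfctE => dX; apply: is_derive_eq.
  rewrite /GRing.scale/= /cst mulr1 mulr0 addr0 mulrA mulVf// mul1r.
  by [].
apply: is_derive_eq.
by rewrite exprS; field; rewrite gt_eqF.
Qed.

(** The remainder vanishes at [0], so by the mean value theorem it equals q c^N / (1 - c) for some 0
    <= c <= q; replacing [c] by [q] only increases this. *)
Lemma log_sum_bounds N q : 0 <= q < 1 ->
  0 <= - ln (1 - q) - log_sum N q <= q ^+ N * (q / (1 - q)).
Proof.
move=> /andP[q0 q1]; have q10 : 0 < 1 - q by rewrite subr_gt0.
have cD : {within `[0, q], continuous (fun q => - ln (1 - q) - log_sum N q)}.
  apply: continuous_in_subspaceT => s /[!inE]; rewrite /= in_itv/= => /andP[_ sq].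
  apply/differentiable_continuous/derivable1_diffP.
  by have [] := is_derive_log_sum N (le_lt_trans sq q1).
have dD s : s \in `]0, q[ -> is_derive s 1
    (fun q => - ln (1 - q) - log_sum N q) (s ^+ N / (1 - s)).
  by rewrite in_itv/= => /andP[_ sq]; exact: is_derive_log_sum (lt_trans sq q1).
have [c] := MVT_segment q0 dD cD.
rewrite in_itv/= !subr0 => /andP[c0 cq].
rewrite ln1 oppr0 sub0r {2}/log_sum big1 => [|n _]; last by rewrite expr0n mul0r.
rewrite oppr0 subr0 => ->; have c1 : 0 < 1 - c.
  by rewrite subr_gt0 (le_lt_trans cq).
rewrite mulr_ge0 ?divr_ge0 ?exprn_ge0 ?(ltW c1)//=.
rewrite -mulrA (mulrC _ q); apply: ler_pM; rewrite ?exprn_ge0//.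
- by rewrite mulr_ge0 ?invr_ge0 ?(ltW c1).
- by rewrite lerXn2r ?nnegrE.
- by rewrite ler_wpM2l// lef_pV2 ?posrE// lerB.
Qed.

Lemma log_sum_cvg q : 0 <= q < 1 -> log_sum N q @[N --> \oo] --> - ln (1 - q).
Proof.
move=> q01; have /andP[q0 q1] := q01.
have lim0 : q ^+ N * (q / (1 - q)) @[N --> \oo] --> 0.
  rewrite -[X in _ --> X](mul0r (q / (1 - q))).
  by apply: cvgM; [apply: cvg_expr; rewrite ger0_norm|exact: cvg_cst].
apply: (@squeeze_cvgr _ _ _ _
  (fun N => - ln (1 - q) - q ^+ N * (q / (1 - q))) (fun=> - ln (1 - q))).
- near=> N; have := log_sum_bounds N q01; lra.
- rewrite -[X in _ --> X]subr0; apply: cvgB => //; exact: cvg_cst.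
- exact: cvg_cst.
Unshelve. all: by end_near. Qed.

Lemma log_sum_ge0 N q : 0 <= q -> 0 <= log_sum N q.
Proof. by move=> q0; apply: sumr_ge0 => n _; rewrite mulr_ge0// exprn_ge0. Qed.

Lemma log_sum_nd q : 0 <= q -> {homo log_sum^~ q : m n / (m <= n)%N >-> m <= n}.
Proof.
move=> q0; apply/nondecreasing_seqP => n.
by rewrite /log_sum big_ord_recr/= lerDl mulr_ge0// exprn_ge0.
Qed.

(** For z > 0 this is the sum over n >= 1 of e^(-nz)/n, the factor that each summation index
    contributes to the kernel. *)
Definition Lexp z : R := - ln (1 - expR (- z)).

Lemma Lexp_arg_gt0 z : 0 < z -> 0 < 1 - expR (- z).
Proof. by move=> z0; rewrite subr_gt0 expR_lt1 oppr_lt0. Qed.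

Lemma Lexp_ge0 z : 0 < z -> 0 <= Lexp z.
Proof.
move=> z0; rewrite oppr_ge0 ln_le0// gerBl expR_ge0//.
Qed.

Lemma Lexp_ge_ln z : 0 < z -> - ln z <= Lexp z.
Proof.
move=> z0; rewrite lerN2 ler_ln ?posrE ?Lexp_arg_gt0//.
by rewrite lerBlDl -lerBlDr (le_trans _ (expR_ge1Dx _)).
Qed.

(** Equivalent to z e^(-z) <= 1 - e^(-z), that is, to 1 + z <= e^z. *)
Lemma Lexp_le_ln z : 0 < z -> Lexp z <= - ln z + z.
Proof.
move=> z0; rewrite lerNl opprD opprK.
have -> : ln z - z = ln (z / expR z) by rewrite ln_div ?posrE ?expR_gt0// expRK.
rewrite ler_ln ?posrE ?divr_gt0 ?expR_gt0 ?Lexp_arg_gt0//.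
rewrite expRN ler_pdivrMr ?expR_gt0// mulrBl mul1r mulVf ?gt_eqF ?expR_gt0//.
by rewrite lerBrDl expR_ge1Dx.
Qed.

(** With y = 1 - e^(-z), - ln y = ln (1/y) <= 1/y - 1 = e^(-z)/y, and 1/y <= 1 + 1/z because 1 + z
    <= e^z. This supplies the decay for large [z]. *)
Lemma Lexp_le_expR z : 0 < z -> Lexp z <= expR (- z) * (1 + z^-1).
Proof.
move=> z0; have y0 := Lexp_arg_gt0 z0.
have z1 : 0 < 1 + z by rewrite addr_gt0.
have h : (1 - expR (- z))^-1 <= 1 + z^-1.
  rewrite -[X in _ <= X]invrK lef_pV2 ?posrE// ?invr_gt0 ?addr_gt0 ?invr_gt0//.
  have -> : (1 + z^-1)^-1 = 1 - (1 + z)^-1.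
    by field; rewrite ?(addrC z) ?(lt0r_neq0 z1) ?(lt0r_neq0 z0).
  by rewrite lerB// expRN lef_pV2 ?posrE ?expR_gt0// expR_ge1Dx.
rewrite /Lexp -lnV ?posrE// (le_trans _ (ler_wpM2l (expR_ge0 _) h))//.
rewrite -[X in ln X](subrKC 1) (le_trans (le_ln1Dx _))//.
  by rewrite ltrBrDl subrr invr_gt0.
have ye : expR (- z) = 1 - (1 - expR (- z)) by rewrite opprB subrKC.
rewrite [X in X / _]ye mulrBl mul1r mulfV ?gt_eqF//.
Qed.

End log_series.

(** * The kernel near the origin and at infinity *)

Section product_estimates.
Context {R : realType}.

(** Factors are exchanged one at a time. Each exchange costs M e times a product of the other
    factors; writing the distance as [M * e] gives every exchange the same cost e M^n, with n the
    length. *)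
Lemma prod_dist_le (I : eqType) (s : seq I) (f g : I -> R) (M e : R) :
  (forall i, i \in s -> [/\ `|f i| <= M, `|g i| <= M & `|f i - g i| <= M * e]) ->
  `|\prod_(i <- s) f i - \prod_(i <- s) g i| <= (size s)%:R * e * M ^+ size s.
Proof.
elim: s => [|i s IH] h; first by rewrite !big_nil subrr normr0 !mul0r.
have [fi gi fgi] := h i (mem_head _ _).
have M0 : 0 <= M by exact: le_trans (normr_ge0 _) fi.
have Me0 : 0 <= M * e by exact: le_trans (normr_ge0 _) fgi.
have hs j : j \in s -> [/\ `|f j| <= M, `|g j| <= M & `|f j - g j| <= M * e].
  by move=> js; apply: h; rewrite in_cons js orbT.
have fs : `|\prod_(j <- s) f j| <= M ^+ size s.
  elim: (s) hs => [|j t IHt] hs; first by rewrite big_nil normr1.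
  rewrite big_cons normrM exprS ler_pM//; first by have [] := hs j (mem_head _ _).
  by apply: IHt => k kt; apply: hs; rewrite in_cons kt orbT.
rewrite !big_cons (_ : _ - _ = (f i - g i) * \prod_(j <- s) f j +
  g i * (\prod_(j <- s) f j - \prod_(j <- s) g j)); last by ring.
rewrite (le_trans (ler_normD _ _))// !normrM /= exprS -natr1.
have -> : ((size s)%:R + 1) * e * (M * M ^+ size s) =
  M * e * M ^+ size s + M * ((size s)%:R * e * M ^+ size s) by ring.
by rewrite lerD// ler_pM// IH.
Qed.

(** Either y <= 1 and 1 + y <= 2, or y >= 1 and 1 + y <= 2y. It reduces powers of 1 - ln t to the
    two logarithmic integrands that are integrated exactly. *)
Lemma exprD1_le (y : R) n : 0 <= y -> (1 + y) ^+ n <= 2 ^+ n * (1 + y ^+ n).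
Proof.
move=> y0; have [y1|/ltW y1] := leP y 1.
  rewrite (@le_trans _ _ (2 ^+ n))//.
    by rewrite lerXn2r ?nnegrE ?addr_ge0//; lra.
  by rewrite ler_peMr ?exprn_ge0// lerDl exprn_ge0.
rewrite (@le_trans _ _ ((2 * y) ^+ n))//.
  by rewrite lerXn2r ?nnegrE ?addr_ge0 ?mulr_ge0//; lra.
by rewrite exprMn ler_wpM2l ?exprn_ge0// lerDr.
Qed.

Variables (r : nat) (w : 'I_r -> R) (a : R).
Hypotheses (w0 : forall i, 0 < w i) (a0 : 0 <= a).

(* Up to the factor [Gamma x], [Mseries x w a] is the Mellin transform of
   [kern], whose behaviour at the origin is that of [kern0]. *)
Definition kern (t : R) : R := expR (- (a * t)) * \prod_(i < r) Lexp (w i * t).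

Definition kern0 (t : R) : R := \prod_(i < r) (- ln t - ln (w i)).

Lemma kern_ge0 t : 0 < t -> 0 <= kern t.
Proof.
move=> t0; rewrite mulr_ge0 ?expR_ge0// prodr_ge0// => i _.
by rewrite Lexp_ge0// mulr_gt0.
Qed.

(** Each [Lexp (w i * t)] is within w_i t of - ln t - ln w_i, so [prod_dist_le] applies with M = A
    (1 - ln t) and e = t. The factor e^(-at) is split off first and adds at most a t M^r. *)
Lemma kern_dist_le : exists2 C : R, 0 <= C &
  forall t, 0 < t -> t <= 1 -> `|kern t - kern0 t| <= C * (t * (1 + (- ln t) ^+ r)).
Proof.
(* Chosen so that A - 1 dominates every w_i + |ln w_i|; then A (1 + y) dominates 1 + y + w_i + |ln
   w_i| for y >= 0. *)
pose A : R := 1 + \sum_(i < r) (w i + `|ln (w i)|).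
have As i : w i + `|ln (w i)| <= A - 1.
  rewrite /A addrAC subrr add0r (bigD1 i)//= lerDl sumr_ge0// => j _.
  by rewrite addr_ge0// ltW.
have A1 : 1 <= A.
  by rewrite /A lerDl sumr_ge0// => j _; rewrite addr_ge0// ltW.
(* Here [a] pays for the exponential factor, [r] for the exchanged factors, and 2^r comes from
   [exprD1_le]. *)
exists ((a + r%:R) * (2 * A) ^+ r).
  by rewrite mulr_ge0 ?addr_ge0 ?exprn_ge0 ?mulr_ge0//; lra.
move=> t t0 t1; set y := - ln t.
have y0 : 0 <= y by rewrite oppr_ge0 ln_le0.
pose M := A * (1 + y).
have M0 : 0 <= M by rewrite mulr_ge0//; lra.
have bnd i : [/\ `|Lexp (w i * t)| <= M, `|y - ln (w i)| <= M &
    `|Lexp (w i * t) - (y - ln (w i))| <= M * t].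
  have wt0 : 0 < w i * t by rewrite mulr_gt0.
  have e1 := Lexp_ge_ln wt0; have e2 := Lexp_le_ln wt0.
  have e3 := Lexp_ge0 wt0; have wt1 : w i * t <= w i by rewrite ler_piMr// ltW.
  rewrite lnM ?posrE// opprD -/y addrC in e1 e2; rewrite -/y in e1 e2.
  have Mw : 1 + y + w i + `|ln (w i)| <= M.
    have := As i => h.
    have : 0 <= (A - 1) * y by rewrite mulr_ge0//; lra.
    by rewrite /M; lra.
  have := ler_norm (ln (w i)); have := ler_norm (- ln (w i)); rewrite normrN => n1 n2.
  have := w0 i => wi.
  split.
  - by rewrite ger0_norm//; lra.
  - by rewrite ler_norml; apply/andP; split; lra.
  (* The two bounds on [Lexp] place the difference between 0 and w_i t, and w_i <= M. *)
  - rewrite ger0_norm; last by lra.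
    rewrite (@le_trans _ _ (w i * t))//; first by lra.
    by rewrite ler_wpM2r ?(ltW t0)//; have := normr_ge0 (ln (w i)); lra.
have Lle : `|\prod_(i < r) Lexp (w i * t)| <= M ^+ r.
  rewrite normr_prod -[X in _ ^+ X](card_ord r) -prodr_const ler_prod// => i _.
  by rewrite normr_ge0; have [] := bnd i.
rewrite /kern /kern0 -/y.
set P := \prod_(i < r) Lexp (w i * t) in Lle *.
have -> : expR (- (a * t)) * P - \prod_(i < r) (y - ln (w i)) =
  (expR (- (a * t)) - 1) * P + (P - \prod_(i < r) (y - ln (w i))) by ring.
have at0 : 0 <= a * t by rewrite mulr_ge0// ltW.
have e1 : `|expR (- (a * t)) - 1| <= a * t.
  rewrite distrC ger0_norm ?subr_ge0 -?expR0 ?ler_expR ?oppr_le0//.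
  rewrite expR0; have := expR_ge1Dx (- (a * t)); lra.
have e2 : `|P - \prod_(i < r) (y - ln (w i))| <= r%:R * t * M ^+ r.
  have := @prod_dist_le _ (index_enum 'I_r) (fun i => Lexp (w i * t))
    (fun i => y - ln (w i)) M t (fun i _ => bnd i).
  suff -> : size (index_enum 'I_r) = r by [].
  by rewrite -sum1_size big_const_ord iter_addn_0 mul1n.
rewrite (le_trans (ler_normD _ _))// normrM.
rewrite (le_trans (lerD (ler_pM _ _ e1 Lle) e2))//.
have -> : a * t * M ^+ r + r%:R * t * M ^+ r =
  (a + r%:R) * A ^+ r * t * (1 + y) ^+ r by rewrite /M exprMn; ring.
rewrite exprMn.
have -> : (a + r%:R) * (2 ^+ r * A ^+ r) * (t * (1 + y ^+ r)) =
  (a + r%:R) * A ^+ r * t * (2 ^+ r * (1 + y ^+ r)) by ring.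
rewrite ler_wpM2l ?exprD1_le//.
by rewrite !mulr_ge0 ?addr_ge0 ?exprn_ge0 ?(ltW t0)//; lra.
Qed.

(** For t >= 1, 1/(w_i t) <= 1/w_i in [Lexp_le_expR]. The factors contribute the decay rate w_1 +
    ... + w_r, which persists when a = 0. *)
Lemma kern_le_expR : exists2 K : R, 0 <= K &
  forall t, 1 <= t -> kern t <= K * expR (- ((a + \sum_(i < r) w i) * t)).
Proof.
exists (\prod_(i < r) (1 + (w i)^-1)).
  by apply: prodr_ge0 => i _; rewrite addr_ge0// invr_ge0 ltW.
move=> t t1; have t0 : 0 < t by exact: lt_le_trans t1.
rewrite mulrDl opprD expRD mulrCA ler_wpM2l ?expR_ge0//.
rewrite mulr_suml -sumrN expR_sum -big_split/=.
apply: ler_prod => i _; have wt0 : 0 < w i * t by rewrite mulr_gt0.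
rewrite Lexp_ge0//= (le_trans (Lexp_le_expR wt0))// mulrC.
rewrite ler_wpM2r ?expR_ge0// lerD2l lef_pV2 ?posrE//.
by rewrite ler_peMr// ltW.
Qed.

(** Expand the product over the set J of factors from which - ln w_i is taken, then group the sets
    by cardinality. *)
Lemma kern0E t : kern0 t =
  \sum_(0 <= k < r.+1) (-1) ^+ k * Lambda k w * (- ln t) ^+ (r - k).
Proof.
rewrite /kern0; set y := - ln t.
under eq_bigr do rewrite addrC.
rewrite bigA_distr.
transitivity (\sum_(J : {set 'I_r}) \sum_(0 <= k < r.+1 | #|J| == k)
    (-1) ^+ k * (\prod_(i in J) ln (w i)) * y ^+ (r - k)); last first.
  rewrite (exchange_big_dep xpredT)//=; apply: eq_bigr => k _.
  by rewrite -mulr_suml -mulr_sumr.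
apply: eq_bigr => J _; have Jr : (#|J| <= r)%N.
  by rewrite -[X in (_ <= X)%N](card_ord r) max_card.
(* For a given J only the index k = #|J| contributes, and #|J| <= r keeps it in range. *)
rewrite big_mkord (big_pred1 (inord #|J|)) => [|k]; last first.
  by rewrite /= -val_eqE /= inordK// eq_sym.
rewrite inordK// (bigID (mem J))/=; congr (_ * _).
  under eq_bigr => i iJ do rewrite iJ.
  by rewrite prodrN.
under eq_bigr => i /negbTE iJ do rewrite iJ.
rewrite (eq_bigl (fun i => i \in ~: J)) => [|i]; last by rewrite finset.in_setC.
by rewrite prodr_const cardsCs finset.setCK card_ord.
Qed.

End product_estimates.

(** * The integral representation *)

Section box_sums.
Context {R : realType} (r : nat).
Implicit Types (f : {ffun 'I_r -> nat} -> \bar R) (N : nat).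

(** Functions into ['I_N] index the box [1, N]^r after a shift by one. This is the index type
    produced by distributing a product of [r] sums of length [N]. *)
Definition ffun_succ N (n : {ffun 'I_r -> 'I_N}) : {ffun 'I_r -> nat} :=
  [ffun i => (n i).+1].

Lemma ffun_succ_inj N : injective (@ffun_succ N).
Proof.
move=> m n /ffunP mn; apply/ffunP => i; apply: val_inj.
by have := mn i; rewrite !ffunE => -[].
Qed.

Let box N := [set n : {ffun 'I_r -> nat} | forall i, (1 <= n i <= N)%N].

Let boxP N : box N = [set` [seq ffun_succ n | n : {ffun 'I_r -> 'I_N}]].
Proof.
apply/seteqP; split=> [n nN|n /mapP[m _ ->] i]; last by rewrite ffunE/=.
have nN' i : ((n i).-1 < N)%N by have /andP[] := nN i; case: (n i).
apply/mapP; exists [ffun i => Ordinal (nN' i)]; first by rewrite mem_enum.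
apply/ffunP => i; rewrite !ffunE/= prednK//.
by have /andP[] := nN i.
Qed.

Let sum_box f N :
  (\sum_(n : {ffun 'I_r -> 'I_N}) f (ffun_succ n) = \sum_(n \in box N) f n)%E.
Proof.
rewrite boxP -fsbig_seq; last by rewrite map_inj_uniq ?enum_uniq//; exact: ffun_succ_inj.
by rewrite big_map big_enum.
Qed.

Let finite_box N : finite_set (box N).
Proof. by rewrite boxP. Qed.

(** The boxes increase and every finite set of admissible tuples lies in one of them, so for
    nonnegative terms the supremum over boxes is the supremum over finite sets. *)
Lemma cvg_esum_box f : (forall n, 0 <= f n)%E ->
  (\sum_(n : {ffun 'I_r -> 'I_N}) f (ffun_succ n))%E @[N --> \oo] -->
  \esum_(n in [set n : {ffun 'I_r -> nat} | forall i, (1 <= n i)%N]) f n.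
Proof.
move=> f0; under eq_fun do rewrite sum_box.
set u := fun N => _.
have ndu : {homo u : m n / (m <= n)%N >-> (m <= n)%E}.
  move=> m n mn; apply: lee_fsum_nneg_subset => //.
  move=> k /set_mem km; apply/mem_set => i; have /andP[-> /=] := km i.
  by move=> /leq_trans; apply.
suff -> : \esum_(n in [set n : {ffun 'I_r -> nat} | forall i, (1 <= n i)%N]) f n =
    ereal_sup (range u) by exact: ereal_nondecreasing_cvgn.
apply/eqP; rewrite eq_le; apply/andP; split; last first.
  apply: ge_ereal_sup => _ [N _ <-]; apply: esum_ge; exists (box N) => //.
  by split => // n nN i; have /andP[] := nN i.
apply: ge_ereal_sup => _ [X [/finite_seqP[Y ->] XS] <-].
(* The sum of all coordinates of all tuples in [Y] bounds each single coordinate. *)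
pose N := (\sum_(n <- Y) \sum_(i < r) n i)%N.
apply: (@le_trans _ _ (u N)); last by apply: ereal_sup_ubound; exists N.
apply: lee_fsum_nneg_subset => //.
move=> n /set_mem/= nY; apply/mem_set => i; rewrite (XS n nY i)/=.
rewrite /N (big_rem n)//= (bigD1 i)//= -addnA; exact: leq_addr.
Qed.

End box_sums.

(** * The Mellin representation of the multiple series *)

Section Mellin_representation.
Context {R : realType}.
Variables (r : nat) (w : 'I_r -> R) (a : R).
Hypotheses (r0 : (0 < r)%N) (w0 : forall i, 0 < w i) (a0 : 0 <= a).
Notation mu := (@lebesgue_measure R).

(** Truncation of [kern] to n_i <= N: a finite combination of exponentials, increasing to [kern] on
    t > 0. *)
Let kern_sum N (t : R) : R :=
  expR (- (a * t)) * \prod_(i < r) log_sum N (expR (- (w i * t))).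

Let kern_sum_ge0 N t : 0 <= kern_sum N t.
Proof.
by rewrite mulr_ge0 ?expR_ge0// prodr_ge0// => i _; rewrite log_sum_ge0 ?expR_ge0.
Qed.

Let kern_sum_nd t : {homo kern_sum^~ t : m n / (m <= n)%N >-> m <= n}.
Proof.
move=> m n mn; rewrite ler_wpM2l ?expR_ge0// ler_prod// => i _.
by rewrite log_sum_ge0 ?expR_ge0//= log_sum_nd ?expR_ge0.
Qed.

Let kern_sum_cvg t : 0 < t -> kern_sum N t @[N --> \oo] --> kern w a t.
Proof.
move=> t0; apply: cvgM; first exact: cvg_cst.
apply: cvg_big => [z|i _]; first exact: mul_continuous.
by apply: log_sum_cvg; rewrite expR_ge0/= expR_lt1 oppr_lt0 mulr_gt0.
Qed.

Let measurable_kern_sum N (D : set R) : measurable_fun D (kern_sum N).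
Proof.
apply: measurable_funM; first exact: measurable_expRNM.
apply: measurable_prod => i _.
apply: measurable_sum => n; apply: measurable_funM => //.
by apply: measurable_funX; exact: measurable_expRNM.
Qed.

Lemma measurable_kern : measurable_fun (`]0, +oo[ : set R) (kern w a).
Proof.
apply: (measurable_fun_cvg (h := kern_sum)) => [N|t].
  exact: measurable_kern_sum.
by rewrite /= in_itv/= andbT => t0; exact: kern_sum_cvg.
Qed.

Let kern_sumE N (t : R) : kern_sum N t =
  \sum_(n : {ffun 'I_r -> 'I_N}) (\prod_(i < r) (n i).+1%:R)^-1 *
     expR (- ((\sum_(i < r) w i * (n i).+1%:R + a) * t)).
Proof.
rewrite /kern_sum /log_sum bigA_distr_bigA/= mulr_sumr; apply: eq_bigr => n _.
rewrite mulrDl opprD expRD [RHS]mulrA [RHS]mulrC; congr (_ * _).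
rewrite mulr_suml -sumrN expR_sum -prodfV -big_split/=; apply: eq_bigr => i _.
rewrite mulrC; congr (_ * _).
by rewrite -expRM_natr; congr expR; ring.
Qed.

(** On each box the identity is a finite sum of scaled Gamma integrals; both sides then pass to the
    limit, the left by [cvg_esum_box], the right by monotone convergence. As an identity of extended
    reals it does not presuppose convergence of the series. *)
Lemma Gamma_Mseries x : 0 < x ->
  ((Gamma (x + 1))%:E * Mseries x w a =
   \int[mu]_(t in `]0%R, +oo[) (x * t `^ (x - 1) * kern w a t)%:E)%E.
Proof.
move=> x0.
pose s (n : 'I_r -> nat) := \sum_(i < r) w i * (n i)%:R + a.
pose f (n : {ffun 'I_r -> nat}) : \bar R :=
  ((\prod_(i < r) (n i)%:R * s n `^ x)^-1)%:E.
have f0 n : (0 <= f n)%E.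
  by rewrite lee_fin invr_ge0 mulr_ge0 ?powR_ge0// prodr_ge0.
have mg N : measurable_fun (`]0, +oo[ : set R)
    (fun t => (x * t `^ (x - 1) * kern_sum N t)%:E).
  apply/measurable_EFinP/measurable_funM => //.
  by apply: measurable_funM => //; apply: measurable_funTS; exact: measurable_powR.
have fE N : ((Gamma (x + 1))%:E *
    \sum_(n : {ffun 'I_r -> 'I_N}) f (ffun_succ n) =
    \int[mu]_(t in `]0%R, +oo[) (x * t `^ (x - 1) * kern_sum N t)%:E)%E.
  have sE (n : {ffun 'I_r -> 'I_N}) :
      s (ffun_succ n) = \sum_(i < r) w i * (n i).+1%:R + a.
    by rewrite /s; congr (_ + _); apply: eq_bigr => i _; rewrite ffunE.
  rewrite ge0_sume_distrr//.
  transitivity (\int[mu]_(t in `]0%R, +oo[)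
    \sum_(n : {ffun 'I_r -> 'I_N}) ((\prod_(i < r) (n i).+1%:R)^-1%:E *
     (x * t `^ (x - 1) * expR (- (s (ffun_succ n) * t)))%:E))%E; last first.
    apply: eq_integral => t _; rewrite kern_sumE mulr_sumr -sumEFin.
    by apply: eq_bigr => n _; rewrite sE -EFinM [in RHS]mulrCA.
  have p0 (n : {ffun 'I_r -> 'I_N}) : 0 <= (\prod_(i < r) (n i).+1%:R)^-1 :> R.
    by rewrite invr_ge0 prodr_ge0.
  have h0 c t : (0 <= (x * t `^ (x - 1) * expR (- (c * t)))%:E)%E.
    by rewrite lee_fin !mulr_ge0 ?powR_ge0 ?expR_ge0// ltW.
  have mh c : measurable_fun (`]0, +oo[ : set R)
      (fun t : R => (x * t `^ (x - 1) * expR (- (c * t)))%:E).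
    by apply/measurable_EFinP; exact: measurable_powR_expR.
  rewrite ge0_integral_sum//.
  - apply: eq_bigr => n _; rewrite ge0_integralZl_EFin//; last exact: mh.
    (* As [a] may be 0, positivity comes from a single summand w_i n_i, available because r > 0. *)
    have sn0 : 0 < s (ffun_succ n).
      rewrite ltr_wpDr// (bigD1 (Ordinal r0))//= ltr_wpDr//.
        by apply: sumr_ge0 => i _; rewrite mulr_ge0// ltW.
      by rewrite mulr_gt0// ffunE ltr0n.
    rewrite (integral_powR_expR x0 sn0) GammaE// -!EFinM; congr EFin.
    rewrite powRN invfM.
    have -> : \prod_(i < r) (ffun_succ n i)%:R = \prod_(i < r) (n i).+1%:R :> R.
      by apply: eq_bigr => i _; rewrite ffunE.
    by rewrite mulrC -mulrA.
  - by move=> n; exact: (measurable_funeM _ (mh _)).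
  - by move=> n t _; rewrite mule_ge0// lee_fin.
have cM : ((Gamma (x + 1))%:E * \sum_(n : {ffun 'I_r -> 'I_N}) f (ffun_succ n))%E
    @[N --> \oo] --> ((Gamma (x + 1))%:E * Mseries x w a)%E.
  apply: cvgeZl => //; exact: cvg_esum_box f0.
rewrite (funext fE) in cM; apply: (cvg_unique _ cM) => //.
have -> : (\int[mu]_(t in `]0%R, +oo[) (x * t `^ (x - 1) * kern w a t)%:E =
  \int[mu]_(t in `]0%R, +oo[)
    limn (fun N => (x * t `^ (x - 1) * kern_sum N t)%:E))%E.
  apply: eq_integral => t; rewrite inE/= in_itv/= andbT => t0.
  apply/esym/cvg_lim => //; apply: cvg_EFin; first exact: nearW.
  by apply: cvgM; [exact: cvg_cst|exact: kern_sum_cvg].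
apply: cvg_monotone_convergence => //.
- move=> N t _; rewrite lee_fin mulr_ge0 ?kern_sum_ge0//.
  by rewrite mulr_ge0 ?powR_ge0// ltW.
- move=> t _ m n mn; rewrite lee_fin ler_wpM2l ?kern_sum_nd//.
  by rewrite mulr_ge0 ?powR_ge0// ltW.
Qed.

End Mellin_representation.

(** * The expansion at the origin *)

Section asymptotics.
Context {R : realType}.
Variables (r : nat) (w : 'I_r -> R) (a : R).
Hypotheses (r0 : (0 < r)%N) (w0 : forall i, 0 < w i) (a0 : 0 <= a).
Notation mu := (@lebesgue_measure R).
Implicit Types (x t : R) (m : nat).

Let pln x m t : R := x * t `^ (x - 1) * (- ln t) ^+ m.

Let pln_ge0 x m t : 0 < x -> 0 < t -> t <= 1 -> 0 <= pln x m t.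
Proof.
move=> x0 t0 t1; rewrite !mulr_ge0 ?powR_ge0 ?(ltW x0)//.
by rewrite exprn_ge0// oppr_ge0 ln_le0.
Qed.

Let measurable_pln x m (D : set R) : measurable_fun D (pln x m).
Proof.
apply: measurable_funM.
  by apply: measurable_funM => //; apply: measurable_funTS; exact: measurable_powR.
apply: measurable_funX; apply: measurableT_comp => //.
by apply: measurable_funTS; exact: measurable_ln.
Qed.

Let integrable_pln x m : 0 < x -> mu.-integrable `]0%R, 1%R] (EFin \o pln x m).
Proof.
move=> x0; apply/integrableP; split.
  by apply/measurable_EFinP; exact: measurable_pln.
rewrite [X in (X < _)%E](_ : _ = (m`!%:R / x ^+ m)%:E) ?ltry//.
rewrite -integral_powR_ln//; apply: eq_integral => t.
rewrite inE/= in_itv/= => /andP[t0 t1].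
by rewrite ger0_norm// pln_ge0.
Qed.

Definition main_term x : R :=
  \sum_(0 <= k < r.+1) (-1) ^+ k * Lambda k w * ((r - k)`!%:R / x ^+ (r - k)).

Let pln_kern0E x : (fun t => (x * t `^ (x - 1) * kern0 w t)%:E) =
  (fun t => \sum_(0 <= k < r.+1)
    (((-1) ^+ k * Lambda k w)%:E * (pln x (r - k) t)%:E)%E).
Proof.
apply/funext => t; rewrite kern0E mulr_sumr -sumEFin; apply: eq_bigr => k _.
by rewrite /pln -EFinM mulrCA.
Qed.

Let integrable_kern0 x : 0 < x ->
  mu.-integrable `]0%R, 1%R] (fun t => (x * t `^ (x - 1) * kern0 w t)%:E).
Proof.
move=> x0; rewrite pln_kern0E; apply: integrable_sum => //= k _.
by apply: integrableZl => //; exact: integrable_pln.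
Qed.

Let integral_kern0 x : 0 < x ->
  (\int[mu]_(t in `]0%R, 1%R]) (x * t `^ (x - 1) * kern0 w t)%:E =
  (main_term x)%:E)%E.
Proof.
move=> x0; rewrite pln_kern0E integral_sum//=; last first.
  by move=> k; apply: integrableZl => //; exact: integrable_pln.
rewrite /main_term -sumEFin; apply: eq_bigr => k _.
rewrite integralZl//; last exact: integrable_pln.
by rewrite integral_powR_ln.
Qed.

Let measurable_pkern x (D : set R) : measurable D -> D `<=` `]0, +oo[ ->
  measurable_fun D (fun t => (x * t `^ (x - 1) * kern w a t)%:E).
Proof.
move=> mD Dpos; apply/measurable_EFinP/measurable_funM.
  by apply: measurable_funM => //; apply: measurable_funTS; exact: measurable_powR.
apply: measurable_funS Dpos _ => //; exact: measurable_kern.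
Qed.

(** The extra factor t in the kernel error raises the exponent: x t^(x-1) t is x/(x+1) times (x+1)
    t^x. The error integral is thus x/(x+1) times exact integrals at x + 1, which stay bounded as x
    tends to 0. *)
Lemma integral_kern_near0 : exists2 C : R, 0 <= C &
  forall x, 0 < x -> exists2 d : R, `|d| <= C * x &
    (\int[mu]_(t in `]0%R, 1%R]) (x * t `^ (x - 1) * kern w a t)%:E =
     (main_term x + d)%:E)%E.
Proof.
have [C C0 hC] := kern_dist_le w0 a0.
exists (C * (1 + r`!%:R)); first by rewrite mulr_ge0// addr_ge0.
move=> x x0; have x10 : 0 < x + 1 by rewrite addr_gt0.
have x11 : 1 <= x + 1 by rewrite lerDr ltW.
(* The quotient x/(x+1) renormalises the weight to the exponent x + 1; it is at most [x], hence the
   O(x). *)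
pose b : R := C * (x / (x + 1)).
have b0 : 0 <= b by rewrite mulr_ge0// divr_ge0// ltW.
pose h t : \bar R := (b%:E * ((pln (x + 1) 0 t)%:E + (pln (x + 1) r t)%:E))%E.
have ih : mu.-integrable `]0%R, 1%R] h.
  by apply: integrableZl => //; apply: integrableD => //; exact: integrable_pln.
have hE : (\int[mu]_(t in `]0%R, 1%R]) h t =
    (b * (1 + r`!%:R / (x + 1) ^+ r))%:E)%E.
  rewrite integralZl//; last by apply: integrableD => //; exact: integrable_pln.
  rewrite integralD//; try exact: integrable_pln.
  by rewrite !integral_powR_ln// fact0 expr0 divr1.
pose g t : \bar R := (x * t `^ (x - 1) * (kern w a t - kern0 w t))%:E.
have mg : measurable_fun (`]0, 1] : set R) g.
  rewrite (_ : g = fun t => ((x * t `^ (x - 1) * kern w a t)%:E -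
      (x * t `^ (x - 1) * kern0 w t)%:E)%E); last first.
    by apply/funext => t; rewrite /g mulrBr EFinB.
  apply: emeasurable_funB.
    by apply: measurable_pkern => // t; rewrite /= !in_itv/= andbT => /andP[].
  by have /integrableP[] := integrable_kern0 x0.
have gh t : t \in `]0, 1] -> (`|g t| <= h t)%E.
  rewrite in_itv/= => /andP[t0 t1].
  have xt0 : 0 <= x * t `^ (x - 1) by rewrite mulr_ge0 ?powR_ge0// ltW.
  rewrite /g /h -EFinD -EFinM lee_fin normrM ger0_norm//.
  rewrite (le_trans (ler_wpM2l xt0 (hC t t0 t1)))//.
  rewrite /pln /b addrK -(mulr_powRB1 (ltW t0) x0) le_eqVlt; apply/orP; left.
  by apply/eqP; field; rewrite gt_eqF.
have ig : mu.-integrable `]0%R, 1%R] g.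
  apply: le_integrable ih => // t t01.
  by rewrite (le_trans (gh t t01))// lee_abs.
have gfin : (\int[mu]_(t in `]0%R, 1%R]) g t)%E \is a fin_num.
  exact: integrable_fin_num.
exists (fine (\int[mu]_(t in `]0%R, 1%R]) g t)%E).
  rewrite -lee_fin -abse_EFin fineK//.
  apply: le_trans; first exact: le_abse_integral.
  apply: (@le_trans _ _ (\int[mu]_(t in `]0%R, 1%R]) h t)%E).
    apply: ge0_le_integral => //.
    - exact: measurableT_comp.
    - by have /integrableP[] := ih.
  rewrite hE lee_fin /b.
  have xx : x / (x + 1) <= x by rewrite ler_pdivrMr// ler_peMr// ltW.
  have fx : r`!%:R / (x + 1) ^+ r <= r`!%:R :> R.
    by rewrite ler_pdivrMr ?exprn_gt0// ler_peMr// exprn_ege1.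
  rewrite -mulrA -[leRHS]mulrA ler_wpM2l// [leRHS]mulrC.
  apply: ler_pM => //; first by rewrite divr_ge0// ltW.
    by rewrite addr_ge0// divr_ge0// exprn_ge0// ltW.
  by rewrite lerD2l.
(* The integral of [kern0] is exactly [main_term]; the difference [g] accounts for [d]. *)
rewrite EFinD fineK// -integral_kern0// -integralD//; last exact: integrable_kern0.
by apply: eq_integral => t _; rewrite /g -EFinD mulrBr subrKC.
Qed.

(** For x <= 1 and t >= 1, t^(x-1) <= 1, so the tail is at most x K times the integral of e^(-St),
    itself at most 1/S. The value must be finite for every x > 0, so only the bound is restricted to
    x <= 1. *)
Lemma integral_kern_tail : exists2 C : R, 0 <= C &
  forall x, 0 < x -> exists2 d : R, x <= 1 -> `|d| <= C * x &
    (\int[mu]_(t in `]1%R, +oo[) (x * t `^ (x - 1) * kern w a t)%:E = d%:E)%E.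
Proof.
have [K K0] := kern_le_expR a w0; set S := a + _ => hK.
have : 0 < S.
  rewrite ltr_wpDl// (bigD1 (Ordinal r0))//= ltr_wpDr//.
  by apply: sumr_ge0 => i _; rewrite ltW.
move: S hK => S hK S0; exists (K / S); first by rewrite divr_ge0// ltW.
move=> x x0.
have tpos t : `]1, +oo[%classic t -> 0 < t.
  by rewrite /= in_itv/= andbT; exact: lt_trans.
have mk : measurable_fun (`]1, +oo[ : set R)
    (fun t => (x * t `^ (x - 1) * kern w a t)%:E).
  by apply: measurable_pkern => // t /tpos; rewrite /= in_itv/= andbT.
have k0 t : `]1, +oo[%classic t -> (0 <= (x * t `^ (x - 1) * kern w a t)%:E)%E.
  move=> /tpos t0; rewrite lee_fin mulr_ge0 ?kern_ge0//.
  by rewrite mulr_ge0 ?powR_ge0// ltW.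
have kfin : (\int[mu]_(t in `]1%R, +oo[) (x * t `^ (x - 1) * kern w a t)%:E)%E
    \is a fin_num.
  (* Finiteness without a restriction on the size of [x]: the majorant extends to ]0, +oo[, where it
     is a scaled Gamma integral. *)
  rewrite ge0_fin_numE ?integral_ge0//.
  pose h t := (K%:E * (x * t `^ (x - 1) * expR (- (S * t)))%:E)%E.
  have mh (D : set R) : measurable_fun D h.
    by apply: measurable_funeM; apply/measurable_EFinP; exact: measurable_powR_expR.
  have h0 t : (0 <= h t)%E.
    by rewrite lee_fin !mulr_ge0 ?powR_ge0 ?expR_ge0// ltW.
  apply: (@le_lt_trans _ _ (\int[mu]_(t in `]1%R, +oo[) h t)%E).
    apply: ge0_le_integral => //; first exact: mh.
    move=> t t1; have t0 := tpos t t1.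
    rewrite /h -EFinM lee_fin [leRHS]mulrCA.
    rewrite ler_wpM2l ?mulr_ge0 ?powR_ge0 ?(ltW x0)//.
    by apply: hK; move: t1; rewrite /= in_itv/= andbT => /ltW.
  apply: (@le_lt_trans _ _ (\int[mu]_(t in `]0%R, +oo[) h t)%E).
    apply: ge0_subset_integral => //; first exact: mh.
    by move=> t /tpos; rewrite /= in_itv/= andbT.
  rewrite ge0_integralZl_EFin//; last 2 first.
  - by move=> t _; rewrite lee_fin !mulr_ge0 ?powR_ge0 ?expR_ge0// ltW.
  - by apply/measurable_EFinP; exact: measurable_powR_expR.
  by rewrite integral_powR_expR// GammaE// -!EFinM ltry.
exists (fine (\int[mu]_(t in `]1%R, +oo[) (x * t `^ (x - 1) * kern w a t)%:E)%E);
  last by rewrite fineK.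
move=> x1; rewrite ger0_norm ?fine_ge0 ?integral_ge0// -lee_fin fineK//.
pose h t := ((K / S * x)%:E * (S * expR (- (S * t)))%:E)%E.
have mh (D : set R) : measurable_fun D h.
  apply: measurable_funeM; apply/measurable_EFinP; apply: measurable_funM => //.
  exact: measurable_expRNM.
have h0 t : (0 <= h t)%E.
  by rewrite lee_fin !mulr_ge0 ?invr_ge0 ?expR_ge0// ltW.
apply: (@le_trans _ _ (\int[mu]_(t in `]1%R, +oo[) h t)%E).
  apply: ge0_le_integral => //; first exact: mh.
  move=> t t1; have t0 := tpos t t1.
  have {}t1 : 1 <= t by move: t1; rewrite /= in_itv/= andbT => /ltW.
  have KS : K / S * x * (S * expR (- (S * t))) = x * 1 * (K * expR (- (S * t))).
    by field; rewrite gt_eqF.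
  rewrite /h -EFinM lee_fin KS.
  rewrite ler_pM ?hK ?kern_ge0 ?mulr_ge0 ?powR_ge0 ?(ltW x0)//.
  rewrite ler_wpM2l ?(ltW x0)//.
  by rewrite -[leRHS](powRr0 t) ler_powR// subr_le0.
apply: (@le_trans _ _ (\int[mu]_(t in `[1%R, +oo[) h t)%E).
  apply: ge0_subset_integral => //; first exact: mh.
  by move=> t; rewrite /= !in_itv/= !andbT => /ltW.
rewrite ge0_integralZl_EFin//; last 3 first.
- by move=> t _; rewrite lee_fin mulr_ge0 ?expR_ge0// ltW.
- apply/measurable_EFinP; apply: measurable_funM => //; exact: measurable_expRNM.
- by rewrite !mulr_ge0 ?invr_ge0// ltW.
rewrite integral_expRN_itvcy// -EFinM lee_fin mulr1 ler_piMr//.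
  by rewrite !mulr_ge0 ?invr_ge0// ltW.
by rewrite expR_le1 oppr_le0 ltW.
Qed.

(** The integral representation is cut at t = 1 and the two error terms are added. The right-hand
    side is finite, which later yields convergence of the series. *)
Lemma Gamma_Mseries_main_term : exists2 C : R, 0 <= C &
  forall x, 0 < x -> exists2 d : R, x <= 1 -> `|d| <= C * x &
    ((Gamma (x + 1))%:E * Mseries x w a = (main_term x + d)%:E)%E.
Proof.
have [C1 C10 h1] := integral_kern_near0.
have [C2 C20 h2] := integral_kern_tail.
exists (C1 + C2) => [|x x0]; first exact: addr_ge0.
have [d1 d1x e1] := h1 x x0; have [d2 d2x e2] := h2 x x0.
exists (d1 + d2).
  by move=> x1; rewrite mulrDl (le_trans (ler_normD _ _))// lerD// d2x.
rewrite Gamma_Mseries// addrA EFinD -e1 -e2.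
have -> : `]0, +oo[%classic = `]0, 1%R] `|` `]1%R, +oo[ :> set R.
  apply/seteqP; split => t; rewrite /= !in_itv/= !andbT.
    by move=> t0; case: (leP t 1) => t1; [left; rewrite t0|right].
  by move=> [/andP[]//|]; exact: lt_trans.
rewrite ge0_integral_setU//.
- apply: measurable_pkern; first exact: measurableU.
  move=> t; rewrite /= !in_itv/= !andbT.
  by move=> [/andP[]//|]; exact: lt_trans.
- move=> t tpos; have t0 : 0 < t.
    by case: tpos; rewrite /= !in_itv/= ?andbT; [case/andP|exact: lt_trans].
  by rewrite lee_fin mulr_ge0 ?kern_ge0// mulr_ge0 ?powR_ge0// ltW.
- apply/disj_setPS => t [/=]; rewrite !in_itv/= andbT => /andP[_ t1].
  by rewrite ltNge t1.
Qed.

End asymptotics.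

(** * The asymptotic expansion and the case of unit weights *)

Lemma Lambda1 (R : realType) (r k : nat) :
  Lambda k (fun _ : 'I_r => 1 : R) = (k == 0)%:R.
Proof.
rewrite /Lambda; case: k => [|k] /=.
  rewrite (big_pred1 finset.set0) => [|A]; first by rewrite finset.big_set0.
  by rewrite cards_eq0.
apply: big1 => A /eqP Ak; have /card_gt0P[i iA] : (0 < #|A|)%N by rewrite Ak.
by rewrite (bigD1 i)//= ln1 mul0r.
Qed.

Unset Implicit Arguments.

Theorem theorem1p2 (R : realType) (r : nat) (hr : (0 < r)%N) :
  (forall (w : 'I_r -> R) (a : R), (forall i, 0 < w i) -> 0 <= a ->
    exists2 E : R -> R, E =O_ ((0 : R)^'+) id &
      forall x : R, 0 < x ->
        Mseries x w a =
        ((Gamma (x + 1))^-1 *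
           (\sum_(0 <= k < r.+1)
              (-1) ^+ k * Lambda k w * ((r - k)`!%:R / x ^+ (r - k)))
         + E x)%:E) /\
  exists2 E : R -> R, E =O_ ((0 : R)^'+) id &
    forall x : R, 0 < x ->
      Mseries x (fun _ : 'I_r => 1) 0 =
      ((Gamma (x + 1))^-1 * (r`!%:R / x ^+ r) + E x)%:E.
Proof.
have expansion (w : 'I_r -> R) (a : R) : (forall i, 0 < w i) -> 0 <= a ->
    exists2 E : R -> R, E =O_ ((0 : R)^'+) id & forall x : R, 0 < x ->
      Mseries x w a = ((Gamma (x + 1))^-1 * main_term w x + E x)%:E.
  move=> w0 a0; have [C C0 hC] := Gamma_Mseries_main_term hr w0 a0.
  (* The error is the difference itself. Since [fine] sends infinities to 0, finiteness is checked
     next: [Gamma (x + 1)] is positive, so an infinite series would make the product infinite. *)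
  exists (fun x => fine (Mseries x w a) - (Gamma (x + 1))^-1 * main_term w x);
    last first.
    move=> x x0; have [d _ e] := hC x x0; rewrite addrC subrK fineK//.
    have G0 := Gamma_gt0 x0.
    move: e; case: (Mseries x w a) => [s| |] //=.
      by rewrite gt0_muley ?lte_fin.
    by rewrite gt0_muleNy ?lte_fin.
  apply/eqOP; near=> M; near=> x.
  have x0 : 0 < x by [].
  have x1 : x <= 1 by near: x; apply: nbhs_right_le.
  have [d dC e] := hC x x0; have G0 := Gamma_gt0 x0.
  have -> : fine (Mseries x w a) - (Gamma (x + 1))^-1 * main_term w x =
      (Gamma (x + 1))^-1 * d.
    move: e; case: (Mseries x w a) => [s| |] //=.
    - rewrite -EFinM => -[e]; rewrite -[s](mulKf (lt0r_neq0 G0)) e; ring.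
    - by rewrite gt0_muley ?lte_fin.
    - by rewrite gt0_muleNy ?lte_fin.
  rewrite normrM gtr0_norm ?invr_gt0// (gtr0_norm x0).
  (* The reciprocal of [Gamma (x + 1)] is at most e, so any constant from e C onwards witnesses the
     O(x). *)
  rewrite (@le_trans _ _ (expR 1 * (C * x)))//.
    apply: ler_pM => //; [by rewrite invr_ge0 ltW| |exact: dC].
    rewrite -[leRHS]invrK lef_pV2 ?posrE ?invr_gt0 ?expR_gt0// -expRN.
    exact: Gamma_ge_expRN1.
  rewrite mulrA ler_wpM2r ?(ltW x0)//.
split; first exact: expansion.
have [E EO hE] := expansion (fun=> 1) 0 (fun=> ltr01) (lexx 0).
exists E => // x x0; rewrite hE//; congr ((_ * _ + _)%:E).
(* With unit weights every logarithm vanishes, and only k = 0 survives. *)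
rewrite /main_term big_nat_recl//= subn0 big1 => [|k _].
  by rewrite addr0 Lambda1 !mul1r.
by rewrite Lambda1 mulr0 mul0r.
Unshelve. all: by end_near. Qed.
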